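(* Let $H \subseteq G$ be an inclusion of finite groups, let $N:=\mathrm{core}_G(H)$, and suppose that $N$ is the intersection of $m$ conjugates of $H$ in $G$. Then $H$ has depth $\leq 2m$ in $G$. Moreover, if $N \subseteq \mathcal{Z}(G)$ (the center of $G$), then $H$ has depth $\leq 2m-1$ in $G$.
   Context: $\mathrm{core}_G(H)=\bigcap_{x\in G}xHx^{-1}$ is the largest normal subgroup of $G$ contained in $H$. Let $\mathrm{Irr}(G)=\{\chi_1,\dots,\chi_s\}$ and $\mathrm{Irr}(H)=\{\psi_1,\dots,\psi_r\}$ be the irreducible complex characters; the inclusion matrix is the $r\times s$ matrix $M=(m_{ij})$ with $m_{ij}=\langle \psi_i, \chi_j\!\downarrow_H\rangle$. Powers of $M$ are understood as $M^0=I_r$ (identity), $M^1=M$, $M^2=MM^t$, $M^3=MM^tM$, etc., and inequalities between matrices are entrywise. The matrix $M$ satisfies a depth $k$ inequality ($k\ge 1$) if $M^{k+1}\le qM^{k-1}$ for some positive integer $q$. A depth $k$ inequality implies a depth $k+1$ inequality; ''$H$ has depth $\le k$ in $G$'' means that $M$ satisfies a depth $k$ inequality. *)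

(* Defs.v *)
From HB Require Import structures.
From mathcomp Require Import all_boot all_order all_algebra all_fingroup.
From mathcomp Require Import all_solvable all_field all_character.

Set Implicit Arguments.
Unset Strict Implicit.
Unset Printing Implicit Defensive.

Import Order.TTheory GRing.Theory Num.Theory GroupScope.
Local Open Scope ring_scope.

Definition inclusion_mx (gT : finGroupType) (G H : {group gT}) :
    'M[algC]_(Nirr H, Nirr G) :=
  \matrix_(i, j) '['chi[H]_i, 'Res[H] 'chi[G]_j].

(* The alternating powers M^0 = 1, M^1 = M, M^2 = M M^T, M^3 = M M^T M, ...
   of an r x s matrix; M^n has r rows, and altpow_width r s n columns.  The
   width is defined by steps of two so that M^(n+2) and M^n have convertible
   types and can be compared without a cast. *)
Fixpoint altpow_width (r s n : nat) : nat :=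
  match n with
  | 0 => r
  | 1 => s
  | n'.+2 => altpow_width r s n'
  end.

Fixpoint altpow (R : pzRingType) (r s : nat) (M : 'M[R]_(r, s)) (n : nat) :
    'M[R]_(r, altpow_width r s n) :=
  match n with
  | 0 => 1%:M
  | 1 => M
  | n'.+2 => M *m M^T *m altpow M n'
  end.

(* M^(k+1) <= q M^(k-1) entrywise for some positive integer q.  This is only
   meaningful for k >= 1; the case k = 0 is set to False. *)
Definition depth_inequality (R : numDomainType) (r s : nat)
    (M : 'M[R]_(r, s)) (k : nat) : Prop :=
  match k with
  | 0 => False
  | k'.+1 => exists2 q : nat, (0 < q)%N &
      forall i j, altpow M k'.+2 i j <= q%:R * altpow M k' i j
  end.

Definition has_depth_le (gT : finGroupType) (G H : {group gT}) (k : nat) :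
    Prop :=
  depth_inequality (inclusion_mx G H) k.

(* The x i need not give distinct conjugates.  As x ranges over G, H :^ x =
   x^-1 H x ranges over the same subgroups as x H x^-1. *)
Definition is_inter_of_conjugates (gT : finGroupType) (G H : {group gT})
    (N : {set gT}) (m : nat) : Prop :=
  exists2 x : 'I_m -> gT, (forall i, x i \in G) &
    N = \bigcap_(i < m) (H :^ x i)%g.

(* Main.v *)
(* Write T for the operator Res_H Ind^G on class functions of H.  The entries of
   M^(2n) and M^(2n+1) are <psi_i, T^n psi_j> and <psi_i, T^n Res chi_j>; they
   are natural numbers, so a depth inequality only says that the support of
   M^(k+1) is contained in that of M^(k-1).  Let psi be a character of H whose
   restriction to N = core_G(H) is G-invariant; this holds for every Res chi_j,
   and for every psi_j if N is central.  If phi is an irreducible constituent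
   of T^m psi then phi and psi have a common constituent on N, because T^m psi
   is a multiple of psi there.  Conversely, T^(m-1) psi contains
   Ind_N^H Res_N psi by Mackey's formula, as N is the intersection of H with
   m-1 of its conjugates; hence phi is already a constituent of T^(m-1) psi. *)
Require Import Defs.
From HB Require Import structures.
From mathcomp Require Import all_boot all_order all_algebra all_fingroup.
From mathcomp Require Import all_solvable all_field all_character.

Set Implicit Arguments.
Unset Strict Implicit.
Unset Printing Implicit Defensive.

Import Order.TTheory GRing.Theory Num.Theory GroupScope.
Local Open Scope ring_scope.

Section ResInd.

Variables (gT : finGroupType) (G H : {group gT}).

Definition res_ind (theta : 'CF(H)) : 'CF(H) := 'Res[H] ('Ind[G] theta).

Lemma res_ind_char theta :
  theta \is a character -> res_ind theta \is a character.
Proof. by move=> Ctheta; rewrite cfRes_char ?cfInd_char. Qed.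

Lemma iter_res_ind_char n theta :
  theta \is a character -> iter n res_ind theta \is a character.
Proof. by move=> Ctheta; elim: n => //= n /res_ind_char. Qed.

(* Up to the factor #|K|, this is the inner product on K of two characters. *)
Lemma sum_conj_char_ge0 (K : {group gT}) (theta phi : 'CF(H)) g :
    theta \is a character -> phi \is a character -> K \subset H ->
    K :^ g \subset H ->
  0 <= \sum_(h in K) theta (h ^ g)%g * (phi h)^*.
Proof.
move=> Ctheta Cphi sKH sKgH.
have im : conjgm K g @* K = K :^ g by rewrite morphim_conj setIid.
have sKK : K \subset K by [].
(* [xi] is [theta] pulled back to [K] along conjugation by [g]. *)
pose xi := cfMorph ('Res[conjgm K g @* K] theta).
have Cxi : xi \is a character by rewrite cfMorph_char ?cfRes_char.
have -> : \sum_(h in K) theta (h ^ g)%g * (phi h)^*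
        = #|K|%:R * '[xi, 'Res[K] phi].
  rewrite cfdotE mulrA mulfV ?neq0CG // mul1r; apply: eq_bigr => h Kh.
  by rewrite /xi cfMorphE // !cfResE ?im ?memJ_conjg // conjgmE.
rewrite mulr_ge0 ?ler0n //.
by apply: natr_ge0; apply: Cnat_cfdot_char => //; apply: cfRes_char.
Qed.

Hypothesis sHG : H \subset G.

(* Mackey's formula without double coset representatives: summing over all of
   G instead only changes the multiplicities. *)
Lemma sum_conj_res_ind (K : {group gT}) (theta phi : 'CF(H)) g :
    g \in G -> K :^ g \subset H ->
  \sum_(h in K) res_ind theta (h ^ g)%g * (phi h)^* =
  #|H|%:R^-1 *
    \sum_(u in G) \sum_(h in K :&: H :^ u^-1) theta (h ^ u)%g * (phi h)^*.
Proof.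
move=> Gg sKgH.
have RE h : h \in K -> res_ind theta (h ^ g)%g * (phi h)^* =
    #|H|%:R^-1 * \sum_(u in G) theta (h ^ u)%g * (phi h)^*.
  move=> Kh; have Hhg : (h ^ g)%g \in H by rewrite (subsetP sKgH) ?memJ_conjg.
  rewrite cfResE // cfIndE // -mulrA mulr_suml; congr (_ * _).
  rewrite [RHS](reindex_inj (mulgI g)) /=.
  by apply: eq_big => [u|u _]; rewrite ?groupMl // conjgM.
rewrite (eq_bigr _ RE) -mulr_sumr exchange_big /=; congr (_ * _).
(* [theta] vanishes outside [H], so only the [h] with [h ^ u] in [H] contribute. *)
apply: eq_bigr => u Gu; rewrite [LHS](bigID [in H :^ u^-1]) /= [X in _ + X]big1.
  by rewrite addr0; apply: eq_bigl => h; rewrite inE.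
move=> h /andP[_ nHh]; rewrite [theta _]cfun0 ?mul0r //.
by rewrite mem_conjgV in nHh.
Qed.

Variable N : {group gT}.
Hypotheses (sNH : N \subset H) (nNG : G \subset 'N(N)).

Section Invariant.

Variable psi : 'CF(H).
Hypothesis psiJ : {in N & G, forall z g, psi (z ^ g)%g = psi z}.

(** Conjugates of [z] stay in [N], so the induction formula has #|G| equal terms and each step
    contributes the factor #|G| / #|H|. *)
Lemma iter_res_ind_core n z : z \in N ->
  iter n res_ind psi z = (#|G|%:R / #|H|%:R) ^+ n * psi z.
Proof.
elim: n z => [|n IHn] z Nz; first by rewrite mul1r.
rewrite iterS cfResE ?(subsetP sNH) // cfIndE //.
rewrite (eq_bigr (fun=> (#|G|%:R / #|H|%:R) ^+ n * psi z)).
  rewrite sumr_const -[(_ * _) *+ _]mulr_natl mulrA.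
  by rewrite [_^-1 * _]mulrC exprS mulrA.
by move=> g Gg; rewrite IHn ?memJ_norm ?(subsetP nNG) ?psiJ.
Qed.

Variable phi : 'CF(H).
Hypotheses (Cpsi : psi \is a character) (Cphi : phi \is a character).
Hypothesis psi_phi : 0 < \sum_(h in N) psi h * (phi h)^*.

(** Induction on [ys]: all terms of the Mackey sum are nonnegative, and the term u = y is positive
    by the induction hypothesis for [K :&: H :^ y^-1]. This step changes both [K] and the twist [g],
    hence the generality in them. *)
Lemma sum_iter_res_ind_gt0 (ys : seq gT) (K : {group gT}) g :
    {subset ys <= G} -> g \in G -> K \subset H -> K :^ g \subset H ->
    K :&: \bigcap_(y <- ys) H :^ y^-1 = N ->
  0 < \sum_(h in K) iter (size ys) res_ind psi (h ^ g)%g * (phi h)^*.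
Proof.
elim: ys K g => [|y ys IHys] K g sysG Gg sKH sKgH.
  rewrite big_nil setIT => defK /=; rewrite defK.
  suff -> : \sum_(h in N) psi (h ^ g)%g * (phi h)^* =
            \sum_(h in N) psi h * (phi h)^* by [].
  by apply: eq_bigr => h Nh; rewrite psiJ.
rewrite big_cons setIA => defN.
have Gy : y \in G by rewrite sysG ?mem_head.
have sysG' : {subset ys <= G} by move=> z ysz; rewrite sysG // inE ysz orbT.
rewrite [size _]/= iterS sum_conj_res_ind // mulr_gt0 //.
  by rewrite invr_gt0 ltr0n.
have sKu u : K :&: H :^ u^-1 \subset H by rewrite subIset ?sKH.
have sKuJ u : (K :&: H :^ u^-1) :^ u \subset H.
  by rewrite sub_conjg subsetIr.
rewrite (bigD1 y) //= ltr_wpDr //; last first.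
  exact: (IHys (K :&: H :^ y^-1)%G y sysG' Gy (sKu y) (sKuJ y) defN).
apply: sumr_ge0 => u _.
exact: (sum_conj_char_ge0 (K := (K :&: H :^ u^-1)%G)
  (iter_res_ind_char _ Cpsi) Cphi (sKu u) (sKuJ u)).
Qed.

End Invariant.

(** [theta] is ['chi_i] plus a character, and the restriction of ['chi_i] to [N] already has
    positive norm. *)
Lemma cfdot_Res_irr_neq0 (i : Iirr H) (theta : 'CF(H)) :
    theta \is a character -> '['chi_i, theta] != 0 ->
  '['Res[N] theta, 'Res[N] 'chi_i] != 0.
Proof.
move=> Ctheta; rewrite cfdotC fmorph_eq0 -irr_consttE.
case/(constt_charP _ Ctheta)=> chi' Cchi' ->.
rewrite raddfD cfdotDl gt_eqF // ltr_wpDr //.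
  by apply: natr_ge0; apply: Cnat_cfdot_char; rewrite cfRes_char ?irr_char.
by rewrite cfnorm_gt0 cfRes_eq0 ?irr_char ?irr_neq0.
Qed.

(* Restriction to N loses nothing here, since the iterates of res_ind are
   proportional to psi on N. *)
Lemma iter_res_ind_support (ys : seq gT) (i : Iirr H) (psi : 'CF(H)) :
    {subset ys <= G} -> H :&: \bigcap_(y <- ys) H :^ y^-1 = N ->
    psi \is a character -> {in N & G, forall z g, psi (z ^ g)%g = psi z} ->
    '['chi_i, iter (size ys).+1 res_ind psi] != 0 ->
  '['chi_i, iter (size ys) res_ind psi] != 0.
Proof.
move=> sysG defN Cpsi psiJ nz.
have Cchi := irr_char i.
have psi_chi : 0 < \sum_(h in N) psi h * ('chi_i h)^*.
  rewrite lt_def; apply/andP; split; last first.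
    under eq_bigr => h _ do rewrite -[h in psi h]conjg1.
    by apply: sum_conj_char_ge0; rewrite ?conjsg1.
  have := cfdot_Res_irr_neq0 (iter_res_ind_char _ Cpsi) nz.
  rewrite cfdotE mulf_eq0 negb_or => /andP[_]; apply: contraNneq => z0.
  rewrite (eq_bigr (fun h => (#|G|%:R / #|H|%:R) ^+ (size ys).+1
      * (psi h * ('chi_i h)^*))).
    by rewrite -mulr_sumr z0 mulr0.
  by move=> h Nh; rewrite !(cfResE _ sNH Nh) iter_res_ind_core // mulrA.
have := sum_iter_res_ind_gt0 psiJ Cpsi Cchi psi_chi sysG (group1 G)
  (subxx H).
rewrite conjsg1 subxx => /(_ isT defN) pos.
rewrite cfdotC fmorph_eq0 cfdotE mulf_neq0 ?invr_eq0 ?neq0CG // gt_eqF //.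
by move: pos; under eq_bigr do rewrite conjg1.
Qed.

End ResInd.

Section Depth.

Variables (gT : finGroupType) (G H : {group gT}).

Local Notation M := (inclusion_mx G H).
Local Notation T := (@res_ind gT G H).

Fixpoint altpow_char n : 'I_(altpow_width (Nirr H) (Nirr G) n) -> 'CF(H) :=
  match n with
  | 0 => fun j => 'chi_j
  | 1 => fun j => 'Res[H] 'chi_j
  | n'.+2 => @altpow_char n'
  end.

Lemma altpow_char_char n j : @altpow_char n j \is a character.
Proof.
move: n j; fix IH 1 => -[|[|n]] j /=; last exact: IH.
  exact: irr_char.
by rewrite cfRes_char ?irr_char.
Qed.

Lemma altpow_char_odd n j : odd n ->
  exists k : Iirr G, @altpow_char n j = 'Res[H] 'chi_k.
Proof.
move: n j; fix IH 1 => -[|[|n]] j //=; first by exists j.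
by rewrite negbK; apply: IH.
Qed.

Lemma conj_cfdot_char (K : {group gT}) (phi psi : 'CF(K)) :
  phi \is a character -> psi \is a character -> '[phi, psi]^* = '[phi, psi].
Proof. by move=> Cphi Cpsi; rewrite conj_natr ?Cnat_cfdot_char. Qed.

(** By Frobenius reciprocity, M M^T is the matrix of [T] in the basis of irreducible characters. *)
Lemma altpow_inclusionE n i j :
  altpow M n i j = '['chi_i, iter n./2 T (@altpow_char n j)].
Proof.
move: n i j; fix IH 1 => -[|[|n]] i j; rewrite ?[in LHS]/=.
- by rewrite mxE cfdot_irr.
- by rewrite mxE.
have Cth := iter_res_ind_char G n./2 (altpow_char_char j).
rewrite -mulmxA mxE [X in _ = '[_, X]]/=.
rewrite cfdot_Res_r cfdot_sum_irr; apply: eq_bigr => k _.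
rewrite conj_cfdot_char ?cfInd_char ?irr_char // -cfdot_Res_r mxE.
congr (_ * _); rewrite -cfdot_Res_r cfdot_sum_irr mxE.
apply: eq_bigr => l _; rewrite !mxE IH mulrC; congr (_ * _).
  by rewrite cfdotC conj_cfdot_char ?irr_char.
by rewrite cfdotC.
Qed.

End Depth.

Lemma depth_inequality_support (r s k : nat) (M : 'M[algC]_(r, s)) :
    (forall i j, altpow M k.+2 i j \is a Num.nat) ->
    (forall i j, altpow M k i j \is a Num.nat) ->
    (forall i j, altpow M k.+2 i j != 0 -> altpow M k i j != 0) ->
  depth_inequality M k.+1.
Proof.
move=> natB natA supp.
pose b i j := Num.truncn (altpow M k.+2 i j).
(* Nonzero entries of M^k are at least 1, so any bound on the entries of M^(k+2) serves as q; the
   successor makes it positive. *)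
exists (\sum_i \sum_j b i j).+1 => // i j.
have [->|nzB] := eqVneq (altpow M k.+2 i j) 0.
  by rewrite mulr_ge0 ?ler0n ?natr_ge0.
have nzA := supp i j nzB.
have geA1 : 1 <= altpow M k i j.
  by move: nzA; case/natrP: (natA i j) => -[|a] ->; rewrite ?eqxx // ler1n.
apply: (@le_trans _ _ (\sum_i \sum_j b i j).+1%:R); last first.
  by rewrite -[leLHS]mulr1 ler_wpM2l ?ler0n.
rewrite -(truncnK (natB i j)) ler_nat -/(b i j) ltnW // ltnS.
rewrite (bigD1 i) //= (bigD1 j) //= -addnA; exact: leq_addr.
Qed.

Theorem theorem6p9 (gT : finGroupType) (G H : {group gT}) (m : nat)
    (sHG : H \subset G) (m_gt0 : (0 < m)%N)
    (capN : is_inter_of_conjugates G H (gcore H G) m) :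
  has_depth_le G H (2 * m)%N /\
  (gcore H G \subset ('Z(G))%g -> has_depth_le G H (2 * m - 1)%N).
Proof.
case: m m_gt0 capN => // m _ [x Gx defN].
pose N := [group of gcore H G].
have sNH : N \subset H by apply: gcore_sub.
have nNG : G \subset 'N(N) by apply: gcore_norm.
(* [m] now counts the conjugates other than the first. Conjugation by x_0^-1 turns H :^ x_i into H
   :^ y^-1 with y = x_0 x_i^-1. *)
pose ys := [seq (x ord0 * (x (lift ord0 i))^-1)%g | i <- enum 'I_m].
have sys : size ys = m by rewrite size_map size_enum_ord.
have sysG : {subset ys <= G}.
  by move=> _ /mapP[i _ ->]; rewrite groupM ?groupV.
(* Normality of N lets one of the m conjugates be taken to be H itself. *)
have capH : H :&: \bigcap_(y <- ys) H :^ y^-1 = N.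
  have -> : N = N :^ (x ord0)^-1 :> {set gT}.
    by rewrite (normsP nNG) ?groupV.
  rewrite /= defN big_ord_recl /= conjIg conjsgK; congr (_ :&: _).
  rewrite big_map big_enum /=.
  elim/big_rec2: _ => [|i A B _ ->].
    by apply/setP=> z; rewrite mem_conjg !inE.
  by rewrite conjIg invMg invgK conjsgM.
have depth k : k./2 = m ->
    (forall j : 'I_(altpow_width (Nirr H) (Nirr G) k),
      {in N & G, forall z g, altpow_char j (z ^ g)%g = altpow_char j z}) ->
    has_depth_le G H k.+1.
  move=> k2 inv; apply: depth_inequality_support => i j.
  - rewrite altpow_inclusionE Cnat_cfdot_char ?irr_char //.
    by rewrite iter_res_ind_char ?altpow_char_char.
  - rewrite altpow_inclusionE Cnat_cfdot_char ?irr_char //.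
    by rewrite iter_res_ind_char ?altpow_char_char.
  rewrite !altpow_inclusionE [k.+2./2]/= k2 -sys.
  apply: (iter_res_ind_support sHG sNH nNG) => //.
    exact: (altpow_char_char (n := k)).
  exact: inv.
split=> [|cN].
  (* Here k = 2m + 1: the columns belong to restrictions from [G], which are invariant on [N]. *)
  rewrite mul2n doubleS; apply: depth; first by rewrite /= uphalf_double.
  move=> j z g Nz Gg.
  have /altpow_char_odd : odd m.*2.+1 by rewrite /= odd_double.
  case/(_ _ _ _ j) => k ->.
  by rewrite !cfResE ?(subsetP sNH) ?memJ_norm ?(subsetP nNG) // cfunJ.
(* Here k = 2m: conjugation fixes the central subgroup [N] pointwise. *)
rewrite mul2n doubleS subn1 /=; apply: depth; first by rewrite doubleK.
move=> j z g Nz Gg; congr (altpow_char j _).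
have /centP cz := subsetP (subset_trans cN (subsetIr _ _)) z Nz.
by rewrite conjgE cz // mulKg.
Qed.
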